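(* Let $m\ge 2$, $n\ge1$, let $A\in\mathbb{R}^{m\times n}$ be such that $X=\{x\in\mathbb{R}^n:\ \|Ax\|_\infty\le 1\}$ is bounded. For every $0<c_*\le 0.2$ and every integer $0<k\le n$, $$z_{c_*,k}(X)\ \ge\ c_2\,\sqrt{\frac{k}{\ln m}}\cdot\frac{1}{d_{n-k}(X^\circ)},\qquad\text{where } c_2=0.4\,\sqrt{\ln\big(1/(2c_* )\big)}.$$
   Context: $\|\cdot\|$ is the Euclidean norm. Polar dual: $X^\circ=\{y\in\mathbb{R}^n:\ x\cdot y\le 1\text{ for all }x\in X\}$. Kolmogorov width: for bounded $K\subset\mathbb{R}^n$ and integer $0\le j\le n$, $d_j(K)=\min_P\sup_{x\in K}\|x-Px\|$, the minimum over all orthogonal projections $P$ of $\mathbb{R}^n$ onto $j$-dimensional linear subspaces. Approximation radius: let $B_2^k(r)$ be the closed Euclidean ball of radius $r$ centered at the origin in a $k$-dimensional space. For a $k$-dimensional linear subspace $H\subseteq\mathbb{R}^n$ and $r>0$, let $$\mathrm{vr}(X\cap H,r)=\left(\frac{\mathrm{vol}_k\big(X\cap H\cap B_2^n(r)\big)}{\mathrm{vol}_k\big(B_2^k(r)\big)}\right)^{1/k},$$ with $\mathrm{vol}_k$ the $k$-dimensional Lebesgue measure (in $H$, respectively in $\mathbb{R}^k$), and let $\mathrm{vr}_k(X,r)=\max_H\mathrm{vr}(X\cap H,r)$ over all $k$-dimensional linear subspaces $H$ of $\mathbb{R}^n$. For $0\le c\le1$ and integer $1\le k\le n$, $z_{c,k}(X)=\sup\{r>0:\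 \mathrm{vr}_k(X,r)\ge c\}$. *)

(* Defs.v *)
From HB Require Import structures.
From mathcomp Require Import all_boot all_order all_algebra.
From mathcomp Require Import all_classical all_reals all_analysis.

Set Implicit Arguments.
Unset Strict Implicit.
Unset Printing Implicit Defensive.

Import Order.TTheory GRing.Theory Num.Theory.
Import numFieldNormedType.Exports.

Local Open Scope classical_set_scope.
Local Open Scope ring_scope.

(* k-dimensional Lebesgue measure is the k-fold product of [lebesgue_measure],
   carried to k-tuples; see [lebesgue_tuple_box]. *)
Section lebesgue_tuple.
Variable R : realType.
Let T := measurableTypeR R.

Definition tuple_of_pair k (p : T * k.-tuple T) : k.+1.-tuple T :=
  [tuple of p.1 :: p.2].

Lemma measurable_tuple_of_pair k :
  measurable_fun [set: T * k.-tuple T] (@tuple_of_pair k).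
Proof.
exact: (@measurable_cons _ _ _ _ fst k snd measurable_fst measurable_snd).
Qed.

Section cons_measure.
Variables (k : nat) (mu : {sigma_finite_measure set (k.-tuple T) -> \bar R}).

Definition cons_measure : set (k.+1.-tuple T) -> \bar R :=
  pushforward (lebesgue_measure \x mu)%E (@tuple_of_pair k).

Let cons_measure0 : cons_measure set0 = 0%E.
Proof. by rewrite /cons_measure /pushforward preimage_set0 measure0. Qed.

Let cons_measure_ge0 A : (0 <= cons_measure A)%E.
Proof. by rewrite /cons_measure /pushforward measure_ge0. Qed.

Let cons_measure_sigma_additive : semi_sigma_additive cons_measure.
Proof.
have mt A : measurable A -> measurable (@tuple_of_pair k @^-1` A).
  by move=> mA; rewrite -[X in measurable X]setTI; exact: measurable_tuple_of_pair.
move=> F mF tF mUF; rewrite /cons_measure /pushforward preimage_bigcup.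
apply: measure_semi_sigma_additive.
- by move=> n; exact: mt.
- apply/trivIsetP => i j _ _ ij; rewrite -preimage_setI.
  by move/trivIsetP : tF => /(_ i j Logic.I Logic.I ij) ->; rewrite preimage_set0.
- by rewrite -preimage_bigcup; exact: mt.
Qed.

HB.instance Definition _ := isMeasure.Build _ _ _ cons_measure
  cons_measure0 cons_measure_ge0 cons_measure_sigma_additive.

Let cons_measure_sigma_finite : sigma_finite setT cons_measure.
Proof.
have [F FT Ffin] : sigma_finite setT (lebesgue_measure \x mu)%E.
  have /sigma_finiteP[F [TF ndF Foo]] :=
    sigma_finiteT (@lebesgue_measure R : {sigma_finite_measure set T -> \bar R}).
  have /sigma_finiteP[G [TG ndG Goo]] := sigma_finiteT mu.
  exists (fun n => F n `*` G n).
    rewrite -setXTT TF TG predeqE => -[x y]; split.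
      move=> [/= [n _ Fnx] [l _ Gly]]; exists (maxn n l) => //; split.
      - by move: x Fnx; exact/subsetPset/ndF/leq_maxl.
      - by move: y Gly; exact/subsetPset/ndG/leq_maxr.
    by move=> [n _ []/= ? ?]; split; exists n.
  move=> l; have [? ?] := Foo l; have [? ?] := Goo l.
  split; first exact: measurableX.
  by rewrite product_measure1E// lte_mul_pinfty// ge0_fin_numE.
pose G i : set (k.+1.-tuple T) := [set t | F i (thead t, [tuple of behead t])].
have GE i : @tuple_of_pair k @^-1` G i = F i.
  apply/seteqP; split=> -[x t]; rewrite /G/= /tuple_of_pair theadE/=.
    by congr (F i (_, _)); apply/val_inj.
  by congr (F i (_, _)); apply/val_inj.
exists G.
  apply/seteqP; split=> // t _.
  have : [set: T * k.-tuple T] (thead t, [tuple of behead t]) by [].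
  by rewrite FT => -[i _ Fi]; exists i.
move=> i; have [mF Foo] := Ffin i; split.
  rewrite -[X in measurable X]setTI.
  have mg : measurable_fun [set: k.+1.-tuple T]
      (fun t : k.+1.-tuple T => (thead t, [tuple of behead t])).
    apply/measurable_fun_pair => /=; first exact: measurable_tnth.
    exact: measurable_behead.
  exact: mg.
by rewrite /cons_measure /pushforward GE.
Qed.

HB.instance Definition _ := Measure_isSigmaFinite.Build _ _ _ cons_measure
  cons_measure_sigma_finite.

End cons_measure.

Fixpoint lebesgue_tuple k : {sigma_finite_measure set (k.-tuple T) -> \bar R} :=
  match k with
  | 0 => \d_([tuple] : 0.-tuple T)
  | k'.+1 => cons_measure (lebesgue_tuple k')
  end.

End lebesgue_tuple.

Lemma lebesgue_tuple_box (R : realType) k (A : 'I_k -> set (measurableTypeR R)) :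
  (forall i, measurable (A i)) ->
  lebesgue_tuple R k [set t | forall i, A i (tnth t i)] =
  (\prod_(i < k) lebesgue_measure (A i))%E.
Proof.
elim: k A => [|k IH] A mA.
  rewrite big_ord0 /= diracE mem_set//; by case.
rewrite big_ord_recl -IH//=.
have mB : measurable [set t : k.-tuple (measurableTypeR R) |
    forall i, A (lift ord0 i) (tnth t i)].
  rewrite [X in measurable X](_ : _ =
      \bigcap_(i in [set: 'I_k]) ((@tnth k _)^~ i @^-1` A (lift ord0 i))).
    apply: fin_bigcap_measurable => // i _.
    rewrite -[X in measurable X]setTI; exact: measurable_tnth.
  by apply/seteqP; split=> t /= h; [move=> i _; exact: h|move=> i; exact: (h i)].
rewrite -product_measure1E// /cons_measure /pushforward; congr (_ _).
apply/seteqP; split=> -[x t] /=.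
  by move=> h; split=> [|i]; [exact: (h ord0)|have := h (lift ord0 i); rewrite tnthS].
move=> [h0 h] i; case: (unliftP ord0 i) => [j ->|->]; last exact: h0.
by rewrite tnthS; exact: h.
Qed.

Section euclidean.
Variable R : realType.

(* On matrices [`|x|] is the maximum of the absolute values of the entries, so it
   is the l^oo norm of column vectors; the Euclidean norm is [enorm]. *)
Definition dotp n (x y : 'cV[R]_n) : R := \sum_(i < n) x i 0 * y i 0.
Definition enorm n (x : 'cV[R]_n) : R := Num.sqrt (dotp x x).

Definition eball n (r : R) : set 'cV[R]_n := [set x | enorm x <= r].

Definition linf_polytope m n (A : 'M[R]_(m, n)) : set 'cV[R]_n :=
  [set x | `|A *m x| <= 1].

Definition polar n (X : set 'cV[R]_n) : set 'cV[R]_n :=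
  [set y | forall x, X x -> dotp x y <= 1].

Definition orth_proj n (j : nat) (P : 'M[R]_n) : Prop :=
  [/\ P *m P = P, P^T = P & \rank P = j].

(* For bounded [K] and [j <= n] the suprema are finite and, the set of orthogonal
   projections of rank [j] being compact, the infimum is a minimum. *)
Definition kolmogorov_width n (j : nat) (K : set 'cV[R]_n) : R :=
  inf [set sup [set enorm (x - P *m x) | x in K] | P in orth_proj j].

Definition vol k (A : set 'cV[R]_k) : \bar R :=
  lebesgue_tuple R k [set t | A (\col_i tnth t i)].

Definition orthonormal_frame n k (H : {vspace 'cV[R]_n}) (Q : 'M[R]_(n, k)) :=
  Q^T *m Q = 1%:M /\ forall t : 'cV[R]_k, Q *m t \in H.

Lemma orthonormal_frame_exists n (H : {vspace 'cV[R]_n}) :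
  exists Q : 'M[R]_(n, \dim H), orthonormal_frame H Q.
Proof.
suff frm d : (d <= \dim H)%N -> exists Q : 'M[R]_(n, d), orthonormal_frame H Q.
  exact: frm.
elim: d => [_|d IH dH].
  exists 0; split=> [|t]; first by apply/matrixP => -[].
  by rewrite mul0mx mem0v.
have [Q [QQ QH]] := IH (ltnW dH).
have [v vH vQ] : exists2 v, v \in H & v != Q *m (Q^T *m v).
  apply: contrapT => hv.
  pose f : 'Hom('cV[R]_d, 'cV[R]_n) := linfun (mulmx Q).
  have : (H <= limg f)%VS.
    apply/subvP => v vH; apply/memv_imgP; exists (Q^T *m v); rewrite ?memvf//.
    by rewrite lfunE/=; apply/eqP; apply: contrapT => /negP hv'; apply: hv; exists v.
  move=> /dimvS; rewrite leqNgt => /negP; apply.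
  apply: leq_ltn_trans dH.
  have := limg_ker_dim f fullv; rewrite dimvf /dim/= muln1 => dE.
  by rewrite -[X in (_ <= X)%N]dE leq_addl.
pose w := v - Q *m (Q^T *m v).
have w0 : w != 0 by rewrite subr_eq0.
have wH : w \in H by rewrite rpredB.
have Qw : Q^T *m w = 0 by rewrite mulmxBr [Q^T *m (Q *m _)]mulmxA QQ mul1mx subrr.
have wwE : w^T *m w = (dotp w w)%:M.
  by rewrite [LHS]mx11_scalar mxE; congr _%:M; apply: eq_bigr => i _; rewrite mxE.
have ww_gt0 : 0 < dotp w w.
  have ge0 (i : 'I_n) : 0 <= w i 0 * w i 0 by rewrite -expr2 sqr_ge0.
  rewrite lt_neqAle sumr_ge0// andbT eq_sym; apply: contra w0 => /eqP dw0.
  apply/eqP/matrixP => i j; rewrite ord1 [RHS]mxE; apply/eqP.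
  by rewrite -[_ == _]orbb -mulf_eq0; apply/eqP; apply: (psumr_eq0P _ dw0).
pose u := (enorm w)^-1 *: w.
have Qu : Q^T *m u = 0 by rewrite -scalemxAr Qw scaler0.
have uu : u^T *m u = 1%:M.
  rewrite /u [(_ *: w)^T]linearZ/= -scalemxAl -scalemxAr scalerA wwE scale_scalar_mx.
  by rewrite -invfM -expr2 sqr_sqrtr ?(ltW ww_gt0)// mulVf ?gt_eqF.
suff : exists Q' : 'M[R]_(n, d + 1), orthonormal_frame H Q' by rewrite addn1.
exists (row_mx Q u); split=> [|t].
  rewrite tr_row_mx mul_col_row QQ Qu uu.
  by rewrite -[u^T *m Q]trmxK trmx_mul trmxK Qu trmx0 -scalar_mx_block.
rewrite -[t]vsubmxK mul_row_col rpredD// [dsubmx t]mx11_scalar mul_mx_scalar.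
by rewrite rpredZ// rpredZ.
Qed.

Definition frame n (H : {vspace 'cV[R]_n}) : 'M[R]_(n, \dim H) :=
  xget 0 (orthonormal_frame H).

Lemma frameP n (H : {vspace 'cV[R]_n}) : orthonormal_frame H (frame H).
Proof. by have [Q HQ] := orthonormal_frame_exists H; exact: xgetI HQ. Qed.

(* Lebesgue measure in [H], transported from R^(\dim H) by the linear isometry
   [frame H]; it does not depend on the frame by rotation invariance. *)
Definition vol_in n (H : {vspace 'cV[R]_n}) (A : set 'cV[R]_n) : \bar R :=
  vol [set t | A (frame H *m t)].

Definition vr n (X : set 'cV[R]_n) (H : {vspace 'cV[R]_n}) (r : R) : R :=
  (fine (vol_in H (X `&` [set` H] `&` @eball n r)) /
   fine (vol (@eball (\dim H) r))) `^ (\dim H)%:R^-1.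

(* For compact [X] and [0 < k <= n] the values lie in [0, 1] and the supremum is a
   maximum, by compactness of the set of k-dimensional subspaces. *)
Definition vrk n (k : nat) (X : set 'cV[R]_n) (r : R) : R :=
  sup [set vr X H r | H in [set H | \dim H = k]].

(* Extended real, because the set of radii can be unbounded (e.g. if [c = 0]). *)
Definition approx_radius n (c : R) (k : nat) (X : set 'cV[R]_n) : \bar R :=
  ereal_sup [set r%:E | r in [set r | 0 < r /\ c <= vrk k X r]].

End euclidean.

(* Main.v *)
Require Import Defs.
From mathcomp Require Import all_boot all_order all_algebra.
From mathcomp Require Import all_classical all_reals all_analysis.
From mathcomp Require Import measurable_realfun ring lra.

Import Order.TTheory GRing.Theory Num.Theory.
Import numFieldNormedType.Exports.

Local Open Scope classical_set_scope.
Local Open Scope ring_scope.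

(** Write X as the intersection of the slabs |a_i . x| <= 1, where the a_i are the
    rows of A.  Each a_i lies in the polar of X, so if P is a projection of rank
    n - k that nearly attains the width w = d_(n-k) of the polar, then
    |a_i - P a_i| <= d for every i, with d as close to w as desired.  On the
    k-dimensional space H = ker P the functional a_i acts as a_i - P a_i; thus the
    section of X by H is cut out by m slabs whose normals have norm at most d
    ([section_row_le]).

    In H, a slab with normal b removes from the ball B(r) two caps.  Completing a
    square shows that such a cap lies in the ball of radius sqrt (r^2 - d^-2)
    centred at b / d^2 or its opposite, whose volume is at most
    exp (- k / (2 (d r)^2)) vol B(r) ([vol_cap_le]); only translation invariance
    and homogeneity of Lebesgue measure are involved.  For
    r_0 = sqrt (k / ln m) / (5 d) this factor is m^(-25/2), so the 2 m caps together
    remove at most half of B(r_0) ([vol_polytope_ball_ge_half]).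

    The dependence on c then costs nothing more than homogeneity.  The half of
    B(r_0) that survives also lies in B(r_0 / (2 c)), where it occupies a fraction
    at least (2 c)^k / 2 >= c^k ([vr_ge]).  Hence the approximation radius is at
    least sqrt (k / ln m) / (10 c d) ([approx_radius_ge]), which beats
    c_2 sqrt (k / ln m) / d because sqrt (ln u) <= u / 2 at u = 1 / (2 c)
    ([sqrt_ln_le]): growth that is linear in 1 / c dominates the required
    square root of a logarithm.  Letting d decrease to w concludes. *)

(** * Lebesgue measure on tuples under dilations and translations *)

Section tuple_measure.
Variable R : realType.
Let T := measurableTypeR R.

Definition affine_tuple (a : R) {k} (s : 'I_k -> R) (t : k.-tuple T) :
  k.-tuple T :=
  [tuple a * tnth t i + s i | i < k].

Lemma measurable_affine (a b : R) :
  measurable_fun [set: T] ((fun x => a * x + b) : T -> T).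
Proof. by apply: measurable_funD => //; apply: measurable_funM. Qed.

Lemma measurable_affine_tuple (a : R) k (s : 'I_k -> R) :
  measurable_fun [set: k.-tuple T] (affine_tuple a s).
Proof.
apply/measurable_fun_tnthP => i.
rewrite (_ : _ \o _ = (fun x : T => a * x + s i) \o (fun t => tnth t i)).
  apply: measurableT_comp; first exact: measurable_affine.
  exact: measurable_tnth.
by apply/funext => t /=; rewrite tnth_mktuple.
Qed.

(** The right-hand side is a measure in [A] that agrees with Lebesgue measure on
    half-open intervals. *)
Lemma lebesgue_measure_affine (a b : R) (A : set T) : 0 < a -> measurable A ->
  lebesgue_measure A =
  (a%:E * lebesgue_measure ((fun x : T => (a * x + b)%R : T) @^-1` A))%E.
Proof.
move=> a0 mA.
pose nu : {measure set T -> \bar R} := mscale (NngNum (ltW a0))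
  (pushforward lebesgue_measure ((fun x => a * x + b) : T -> T)).
rewrite (@lebesgue_measure_unique _ (nu (measurable_affine a b))) //.
move=> _ [[u v]] _ <-.
rewrite /nu /= /mscale /= /pushforward.
rewrite (_ : _ @^-1` _ = `](u - b) / a, (v - b) / a]%classic); last first.
  apply/seteqP; split=> x /=; rewrite !in_itv/= ltr_pdivrMr// ler_pdivlMr//;
    by rewrite (mulrC x) ltrBlDr lerBrDr.
rewrite !lebesgue_measure_itv/= !lte_fin ltr_pM2r ?invr_gt0// ltrD2r.
case: ifPn => _; last by rewrite mule0.
rewrite -!EFinB -EFinM; congr (_%:E).
by field; rewrite gt_eqF.
Qed.

(** Induction on the dimension.  A product measure is determined by its values on
    rectangles, and the preimage of a rectangle under an affine map acting
    coordinatewise is again a rectangle. *)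
Lemma lebesgue_tuple_affine (a : R) k (s : 'I_k -> R) (A : set (k.-tuple T)) :
  0 < a -> measurable A ->
  lebesgue_tuple R k A =
  ((a ^+ k)%:E * lebesgue_tuple R k (affine_tuple a s @^-1` A))%E.
Proof.
move=> a0; elim: k s A => [|k IH] s A mA.
  rewrite expr0 mul1e (_ : affine_tuple a s @^-1` A = A)//.
  by apply/seteqP; split=> t /=; rewrite (tuple0 t) (tuple0 (affine_tuple _ _ _)).
pose s' i := s (lift ord0 i).
pose phi (p : T * k.-tuple T) : T * k.-tuple T :=
  (a * p.1 + s ord0, affine_tuple a s' p.2).
have mphi : measurable_fun setT phi.
  apply/measurable_fun_pair => /=.
    by apply: (measurableT_comp (measurable_affine _ _)).
  by apply: (measurableT_comp (measurable_affine_tuple _ _ _)).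
have ak0 : 0 <= a ^+ k.+1 by rewrite exprn_ge0// ltW.
pose mu := (lebesgue_measure \x lebesgue_tuple R k)%E.
pose nu : {measure set (T * k.-tuple T) -> \bar R} :=
  mscale (NngNum ak0) (pushforward mu phi).
have mB : measurable (@tuple_of_pair R k @^-1` A).
  by rewrite -[X in measurable X]setTI; exact: measurable_tuple_of_pair.
rewrite /= /cons_measure /pushforward.
rewrite (@product_measure_unique _ _ _ _ _ _ _ (nu mphi)) //.
  rewrite /nu /= /mscale /= /pushforward; congr (_ * mu _)%E.
  have tE p : tuple_of_pair (phi p) = affine_tuple a s (tuple_of_pair p).
    case: p => x t; apply: eq_from_tnth => i.
    rewrite tnth_mktuple; case: (unliftP ord0 i) => [j|] ->.
      by rewrite !tnthS tnth_mktuple.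
    by rewrite !tnth0.
  by apply/seteqP; split=> p; rewrite /preimage/= tE.
move=> B C mB' mC.
rewrite /nu /= /mscale /= /pushforward.
have -> : phi @^-1` (B `*` C) =
  ((fun x : T => (a * x + s ord0)%R : T) @^-1` B) `*` (affine_tuple a s' @^-1` C).
  by [].
rewrite /mu product_measure1E //.
- rewrite (lebesgue_measure_affine _ (s ord0) _ a0 mB') (IH s' C mC).
  by rewrite exprS EFinM muleACA.
- by rewrite -[X in measurable X]setTI; exact: measurable_affine.
- by rewrite -[X in measurable X]setTI; exact: measurable_affine_tuple.
Qed.

End tuple_measure.

(** * The inner product *)

Section inner_product.
Variable R : realType.

Lemma dotpE n (x y : 'cV[R]_n) : dotp x y = (x^T *m y) 0 0.
Proof. by rewrite mxE; apply: eq_bigr => i _; rewrite mxE. Qed.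

Lemma dotpC n (x y : 'cV[R]_n) : dotp x y = dotp y x.
Proof. by apply: eq_bigr => i _; rewrite mulrC. Qed.

Lemma dotpBl n (x y z : 'cV[R]_n) : dotp (x - y) z = dotp x z - dotp y z.
Proof. by rewrite !dotpE linearB mulmxBl !mxE. Qed.

Lemma dotpZl n (a : R) (x z : 'cV[R]_n) : dotp (a *: x) z = a * dotp x z.
Proof. by rewrite !dotpE [_^T]linearZ/= -scalemxAl mxE. Qed.

Lemma dotpNl n (x z : 'cV[R]_n) : dotp (- x) z = - dotp x z.
Proof. by rewrite -scaleN1r dotpZl mulN1r. Qed.

Lemma dotp_mull m n (M : 'M[R]_(m, n)) (x : 'cV[R]_n) (y : 'cV[R]_m) :
  dotp (M *m x) y = dotp x (M^T *m y).
Proof. by rewrite !dotpE trmx_mul mulmxA. Qed.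

Lemma dotp_ge0 n (x : 'cV[R]_n) : 0 <= dotp x x.
Proof. by apply: sumr_ge0 => i _; rewrite -expr2 sqr_ge0. Qed.

Lemma enorm_ge0 n (x : 'cV[R]_n) : 0 <= enorm x.
Proof. exact: sqrtr_ge0. Qed.

Lemma enorm_le n (x : 'cV[R]_n) (r : R) : 0 <= r ->
  (enorm x <= r) = (dotp x x <= r ^+ 2).
Proof.
move=> r0; rewrite -[X in _ <= X]ger0_norm// -sqrtr_sqr /enorm.
by rewrite ler_sqrt// sqr_ge0.
Qed.

Lemma dotp_isometry n k (Q : 'M[R]_(n, k)) (x y : 'cV[R]_k) :
  Q^T *m Q = 1%:M -> dotp (Q *m x) (Q *m y) = dotp x y.
Proof. by move=> QQ; rewrite dotp_mull mulmxA QQ mul1mx. Qed.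

(** Bessel's inequality, read off from the nonnegativity of |x - Q Q^T x|^2. *)
Lemma dotp_tr_isometry_le n k (Q : 'M[R]_(n, k)) (x : 'cV[R]_n) :
  Q^T *m Q = 1%:M -> dotp (Q^T *m x) (Q^T *m x) <= dotp x x.
Proof.
move=> QQ; have := dotp_ge0 _ (x - Q *m (Q^T *m x)).
rewrite dotpBl 2!(dotpC _ _ (_ - _)) !dotpBl dotp_isometry//.
by rewrite (dotpC _ x (Q *m _)) dotp_mull; lra.
Qed.

End inner_product.

(** * Volumes of balls, caps and polytopes *)

Section volume.
Variable R : realType.
Let T := measurableTypeR R.

(** [vol] is transported from tuples, so measurability is as well. *)
Definition coord_measurable k (A : set 'cV[R]_k) : Prop :=
  measurable [set t : k.-tuple T | A (\col_i tnth t i)].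

Lemma vol_le k (A B : set 'cV[R]_k) :
  coord_measurable k A -> coord_measurable k B -> A `<=` B -> (vol A <= vol B)%E.
Proof. by move=> mA mB AB; apply: le_measure; rewrite ?inE// => t; exact: AB. Qed.

Lemma affine_tuple_col k (a : R) (s : 'cV[R]_k) (t : k.-tuple T) :
  \col_i tnth (affine_tuple R a (fun i => s i 0) t) i =
  a *: (\col_i tnth t i) + s.
Proof. by apply/colP => i; rewrite !mxE tnth_mktuple. Qed.

Lemma vol_affine k (a : R) (s : 'cV[R]_k) (A : set 'cV[R]_k) :
  0 < a -> coord_measurable k A ->
  vol A = ((a ^+ k)%:E * vol [set x | A (a *: x + s)%R])%E.
Proof.
move=> a0 mA; rewrite /vol (lebesgue_tuple_affine _ a _ (fun i => s i 0) _ a0 mA).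
congr (_ * lebesgue_tuple _ _ _)%E; apply/seteqP.
by split=> t /=; rewrite affine_tuple_col.
Qed.

Lemma coord_measurableI k (A B : set 'cV[R]_k) :
  coord_measurable k A -> coord_measurable k B -> coord_measurable k (A `&` B).
Proof. exact: measurableI. Qed.

Lemma coord_measurableU k (A B : set 'cV[R]_k) :
  coord_measurable k A -> coord_measurable k B ->
  coord_measurable k (A `|` B).
Proof. exact: measurableU. Qed.

Lemma coord_measurable_affine k (a : R) (s : 'cV[R]_k) (A : set 'cV[R]_k) :
  coord_measurable k A -> coord_measurable k [set x | A (a *: x + s)].
Proof.
move=> mA; rewrite /coord_measurable.
rewrite [X in measurable X](_ : _ = affine_tuple R a (fun i => s i 0) @^-1`
    [set t : k.-tuple T | A (\col_i tnth t i)]).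
  by rewrite -[X in measurable X]setTI; exact: measurable_affine_tuple.
by apply/seteqP; split=> t; rewrite /preimage/= affine_tuple_col.
Qed.

Lemma coord_measurable_preimage k (f : 'cV[R]_k -> R) (B : set R) :
  measurable_fun [set: k.-tuple T] (fun t => f (\col_i tnth t i)) ->
  measurable B -> coord_measurable k (f @^-1` B).
Proof.
by move=> mf mB; rewrite /coord_measurable -[X in measurable X]setTI; exact: mf.
Qed.

Lemma measurable_dotp k (b : 'cV[R]_k) :
  measurable_fun [set: k.-tuple T] (fun t => dotp b (\col_i tnth t i)).
Proof.
apply: measurable_sum => i; under eq_fun do rewrite mxE.
by apply: measurable_funM => //; exact: measurable_tnth.
Qed.

Lemma coord_measurable_eball k (r : R) : 0 <= r -> coord_measurable k (@eball R k r).
Proof.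
move=> r0; rewrite (_ : eball _ = (fun x => dotp x x) @^-1` [set` `]-oo, r ^+ 2]]).
  apply: coord_measurable_preimage; last exact: measurable_itv.
  apply: measurable_sum => i; under eq_fun do rewrite mxE.
  by apply: measurable_funM; exact: measurable_tnth.
by apply/seteqP; split=> x; rewrite /eball/= in_itv/= enorm_le.
Qed.

Lemma linf_polytopeP m n (A : 'M[R]_(m, n)) (x : 'cV[R]_n) :
  linf_polytope A x <-> forall i, `|dotp (row i A)^T x| <= 1.
Proof.
have rE i : dotp (row i A)^T x = (A *m x) i 0.
  by rewrite mxE; apply: eq_bigr => j _; rewrite !mxE.
rewrite /linf_polytope/= [X in is_true (X <= _)]/Num.Def.normr/= mx_normrE; split.
  by move=> /bigmax_leP[_ h] i; rewrite rE; exact: (h (i, 0)).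
by move=> h; apply/bigmax_leP; split=> // -[i j] _ /=; rewrite ord1 -rE.
Qed.

Lemma linf_polytopeE m n (A : 'M[R]_(m, n)) :
  linf_polytope A =
  \bigcap_(i in [set: 'I_m]) (fun x => dotp (row i A)^T x) @^-1` [set` `[-1, 1]].
Proof.
apply/seteqP; split=> x.
  by move=> /linf_polytopeP h i _; rewrite /preimage/= in_itv/= -ler_norml.
move=> h; apply/linf_polytopeP => i; have := h i I.
by rewrite /preimage/= in_itv/= -ler_norml.
Qed.

Lemma coord_measurable_linf_polytope m k (A : 'M[R]_(m, k)) :
  coord_measurable k (linf_polytope A).
Proof.
rewrite linf_polytopeE /coord_measurable.
rewrite [X in measurable X](_ : _ = \bigcap_(i in [set: 'I_m]) [set t : k.-tuple T |
    ((fun x => dotp (row i A)^T x) @^-1` [set` `[-1, 1]]) (\col_i tnth t i)]) //.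
apply: fin_bigcap_measurable => // i _.
apply: (coord_measurable_preimage _ (dotp (row i A)^T)); last exact: measurable_itv.
exact: measurable_dotp.
Qed.

Lemma coord_measurable_cube k (r : R) :
  coord_measurable k [set x | forall i, `|x i 0| <= r].
Proof.
rewrite /coord_measurable.
rewrite [X in measurable X](_ : _ = \bigcap_(i in [set: 'I_k])
    ((@tnth k T)^~ i @^-1` [set` `[- r, r]])).
  apply: fin_bigcap_measurable => // i _.
  have mt : measurable_fun [set: k.-tuple T] (@tnth k T ^~ i) by exact: measurable_tnth.
  by rewrite -[X in measurable X]setTI; apply: mt => //; exact: measurable_itv.
apply/seteqP; split=> t /= h i.
  by move=> _; have := h i; rewrite mxE /preimage/= in_itv/= -ler_norml.
by have := h i Logic.I; rewrite /preimage/= in_itv/= -ler_norml mxE.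
Qed.

Lemma vol_cube k (r : R) : 0 < r ->
  vol [set x : 'cV[R]_k | forall i, `|x i 0| <= r] = ((2 * r) ^+ k)%:E.
Proof.
move=> r0.
transitivity (lebesgue_tuple R k [set t | forall i, [set` `[- r, r]] (tnth t i)]).
  rewrite /vol; congr (lebesgue_tuple _ _ _); apply/seteqP.
  split=> t /= h i; have := h i; rewrite mxE in_itv/= ler_norml//.
rewrite (@lebesgue_tuple_box R k (fun=> [set` `[- r, r]])); last first.
  by move=> _; exact: measurable_itv.
rewrite lebesgue_measure_itv/= lte_fin gtrN// -EFinB opprK.
by rewrite prodEFin prodr_const card_ord mulr2n mulrDl !mul1r.
Qed.

Lemma vol_eball_lty k (r : R) : 0 < r -> (vol (@eball R k r) < +oo)%E.
Proof.
move=> r0; apply: (@le_lt_trans _ _ (vol [set x : 'cV[R]_k | forall i, `|x i 0| <= r])).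
  apply: vol_le; first by apply: coord_measurable_eball; exact: ltW.
    exact: coord_measurable_cube.
  move=> x; rewrite /eball/= (enorm_le _ _ _ _ (ltW r0)) => xr i.
  rewrite -(@ler_pXn2r _ 2)// ?nnegrE ?(ltW r0)// real_normK ?num_real//.
  apply: le_trans xr; rewrite /dotp (bigD1 i)//= expr2 lerDl.
  by apply: sumr_ge0 => j _; rewrite -expr2 sqr_ge0.
by rewrite vol_cube// ltry.
Qed.

(** The ball of radius [r] contains the cube of half-side [r / (k + 1)]; dividing by
    [k + 1] rather than [k] covers dimension zero. *)
Lemma vol_eball_gt0 k (r : R) : 0 < r -> (0 < vol (@eball R k r))%E.
Proof.
move=> r0; have q0 : 0 < r / k.+1%:R by rewrite divr_gt0.
apply: (@lt_le_trans _ _ (vol [set x : 'cV[R]_k | forall i, `|x i 0| <= r / k.+1%:R])).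
  by rewrite vol_cube// lte_fin exprn_gt0// mulr_gt0.
apply: vol_le; first exact: coord_measurable_cube.
  by apply: coord_measurable_eball; exact: ltW.
move=> x /= h; rewrite /eball/= (enorm_le _ _ _ _ (ltW r0)).
apply: (@le_trans _ _ (\sum_(i < k) (r / k.+1%:R) ^+ 2)).
  apply: ler_sum => i _; rewrite -expr2 -real_normK ?num_real//.
  by rewrite ler_pXn2r ?nnegrE ?(ltW q0).
rewrite sumr_const card_ord -[_ *+ k]mulr_natl exprMn exprVn mulrCA.
rewrite ler_piMr ?sqr_ge0// ler_pdivrMr ?exprn_gt0// mul1r -natrX ler_nat.
by rewrite (leq_trans (leqnSn k))// leq_pmulr.
Qed.

Lemma vol_eball_fin_num k (r : R) : 0 < r -> vol (@eball R k r) \is a fin_num.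
Proof. by move=> r0; rewrite ge0_fin_numE ?vol_eball_lty//; exact: measure_ge0. Qed.

Lemma fine_vol_eball_gt0 k (r : R) : 0 < r -> 0 < fine (vol (@eball R k r)).
Proof. by move=> r0; rewrite fine_gt0// vol_eball_gt0//= vol_eball_lty. Qed.

Lemma coord_measurable_polytope_ball m k (A : 'M[R]_(m, k)) (r : R) : 0 <= r ->
  coord_measurable k (linf_polytope A `&` @eball R k r).
Proof.
move=> r0; apply: coord_measurableI; first exact: coord_measurable_linf_polytope.
exact: coord_measurable_eball.
Qed.

Lemma vol_polytope_ball_le m k (A : 'M[R]_(m, k)) (r : R) : 0 < r ->
  (vol (linf_polytope A `&` @eball R k r) <= vol (@eball R k r))%E.
Proof.
move=> /ltW r0; apply: vol_le; last by move=> x [].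
  exact: coord_measurable_polytope_ball.
exact: coord_measurable_eball.
Qed.

Lemma vol_polytope_ball_fin_num m k (A : 'M[R]_(m, k)) (r : R) : 0 < r ->
  vol (linf_polytope A `&` @eball R k r) \is a fin_num.
Proof.
move=> r0; rewrite ge0_fin_numE; last exact: measure_ge0.
by apply: le_lt_trans (vol_polytope_ball_le _ _ A _ r0) _; exact: vol_eball_lty.
Qed.

Lemma vol_eballM k (a r : R) : 0 < a -> 0 <= r ->
  vol (@eball R k (a * r)) = ((a ^+ k)%:E * vol (@eball R k r))%E.
Proof.
move=> a0 r0; have ar0 : 0 <= a * r by rewrite mulr_ge0// ltW.
rewrite (vol_affine k a 0)//; last exact: coord_measurable_eball.
congr (_ * vol _)%E; apply/seteqP.
have xE x : enorm (a *: x + 0 : 'cV[R]_k) <= a * r = (enorm x <= r).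
  rewrite addr0 !enorm_le// dotpZl dotpC dotpZl mulrA exprMn -expr2.
  by rewrite ler_pM2l// exprn_gt0.
by split=> x; rewrite /eball/= xE.
Qed.

End volume.

(** * Spherical caps *)

Section caps.
Variable R : realType.

Lemma vol_setU_le k (A B : set 'cV[R]_k) :
  coord_measurable R k A -> coord_measurable R k B ->
  (vol (A `|` B) <= vol A + vol B)%E.
Proof. by move=> mA mB; exact: measureU2. Qed.

Lemma vol_bigsetU_le (I : Type) (s : seq I) k (F : I -> set 'cV[R]_k) :
  (forall i, coord_measurable R k (F i)) ->
  coord_measurable R k (\big[setU/set0]_(i <- s) F i) /\
  (vol (\big[setU/set0]_(i <- s) F i) <= \sum_(i <- s) vol (F i))%E.
Proof.
move=> mF; elim: s => [|i s [mU IH]].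
  by rewrite !big_nil; split; [exact: measurable0|rewrite /vol measure0].
rewrite !big_cons; split; first exact: coord_measurableU.
by apply: le_trans (vol_setU_le _ _ _ _ _) _ => //; rewrite leeD2l.
Qed.

Definition cap k (b : 'cV[R]_k) (r : R) : set 'cV[R]_k :=
  [set x | 1 <= dotp b x] `&` @eball R k r.

Lemma coord_measurable_cap k (b : 'cV[R]_k) (r : R) : 0 <= r ->
  coord_measurable R k (cap k b r).
Proof.
move=> r0; apply: coord_measurableI; last exact: coord_measurable_eball.
rewrite (_ : [set _ | _] = dotp b @^-1` [set` `[1, +oo[]).
  apply: coord_measurable_preimage; last exact: measurable_itv.
  exact: measurable_dotp.
by apply/seteqP; split=> x; rewrite /preimage/= in_itv/= andbT.
Qed.

(** For a point [x] of the cap, expanding the square gives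
    [|x - b / d^2|^2 <= r^2 - 2 / d^2 + |b|^2 / d^4 <= r^2 - 1 / d^2], and
    [1 - t <= exp (- t)] with [t = (d r)^-2] turns the right-hand side into the
    square of [exp (- t / 2) r].  When [d r < 1] the cap is empty, and the same
    computation covers this case. *)
Lemma vol_cap_le k (b : 'cV[R]_k) (d r : R) : 0 < d -> 0 < r -> enorm b <= d ->
  (vol (cap k b r) <=
    (expR (- ((d * r) ^- 2 / 2)) ^+ k)%:E * vol (@eball R k r))%E.
Proof.
move=> d0 r0; rewrite (enorm_le _ _ _ _ (ltW d0)) => bd.
set q := expR _; have q0 : 0 < q by exact: expR_gt0.
have qr0 : 0 <= q * r by rewrite mulr_ge0// ltW.
rewrite -vol_eballM ?(ltW r0)//.
pose s := - (d ^- 2 *: b).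
rewrite [leRHS](vol_affine _ _ 1 s)//; last exact: coord_measurable_eball.
rewrite expr1n mul1e; apply: vol_le.
- by apply: coord_measurable_cap; exact: ltW.
- by apply: coord_measurable_affine; exact: coord_measurable_eball.
move=> x [/= bx]; rewrite /eball/= (enorm_le _ _ _ _ (ltW r0)) enorm_le// scale1r => xr.
have -> : dotp (x + s) (x + s) = dotp x x - d ^- 2 * (2 * dotp b x) + d ^- 4 * dotp b b.
  rewrite /s dotpBl dotpZl 2!(dotpC _ _ _ (_ - _)) !dotpBl !dotpZl (dotpC _ _ x b).
  by field; rewrite gt_eqF.
have d20 : 0 < d ^- 2 by rewrite invr_gt0 exprn_gt0.
have dE : d ^- 4 * dotp b b <= d ^- 2.
  rewrite (_ : d ^- 4 = d ^- 2 * d ^- 2); last by field; rewrite gt_eqF.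
  by rewrite -mulrA ger_pMr// ler_pdivrMl ?exprn_gt0// mulr1.
have bE : d ^- 2 * 2 <= d ^- 2 * (2 * dotp b x).
  by rewrite ler_pM2l// ler_peMr.
have qE : r ^+ 2 - d ^- 2 <= (q * r) ^+ 2.
  rewrite exprMn /q -expRM_natr -mulNr divfK//.
  rewrite (_ : _ - _ = (1 - (d * r) ^- 2) * r ^+ 2); last by field; rewrite !gt_eqF.
  by rewrite ler_pM2r ?exprn_gt0// expR_ge1Dx.
by lra.
Qed.

(** Union bound: a point of the ball outside the polytope lies in one of the caps
    cut off by the [2 m] half-spaces [a_i . x > 1] and [- a_i . x > 1]. *)
Lemma vol_polytope_ball_ge m k (A : 'M[R]_(m, k)) (d r : R) :
  0 < d -> 0 < r -> (forall i, enorm (row i A)^T <= d) ->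
  (vol (@eball R k r) <= vol (linf_polytope A `&` @eball R k r) +
    ((2 * expR (- ((d * r) ^- 2 / 2)) ^+ k) *+ m)%:E * vol (@eball R k r))%E.
Proof.
move=> d0 r0 Ad; set q := expR _.
pose F i := cap k (row i A)^T r `|` cap k (- (row i A)^T) r.
have mC b : coord_measurable R k (cap k b r).
  by apply: coord_measurable_cap; exact: ltW.
have mF i : coord_measurable R k (F i) by exact: coord_measurableU.
have mB : coord_measurable R k (@eball R k r).
  by apply: coord_measurable_eball; exact: ltW.
have mP : coord_measurable R k (linf_polytope A `&` @eball R k r).
  by apply: coord_measurable_polytope_ball; exact: ltW.
have [mU vU] := vol_bigsetU_le _ (index_enum 'I_m) _ _ mF.
have sub : @eball R k r `<=` (linf_polytope A `&` @eball R k r) `|`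
    \big[setU/set0]_(i < m) F i.
  move=> x xr.
  have [Ax|/linf_polytopeP/existsNP[i /negP]] := pselect (linf_polytope A x).
    by left.
  rewrite -ltNge => xi; right; rewrite -bigcup_seq/=.
  exists i; first by rewrite /= mem_index_enum.
  move: xi; rewrite ltr_normr => /orP[xi|xi].
    by left; split=> //=; exact: ltW.
  by right; split=> //=; rewrite dotpNl; exact: ltW.
apply: le_trans (vol_le _ _ _ _ _ _ sub) _ => //; first exact: coord_measurableU.
apply: le_trans (vol_setU_le _ _ _ _ _) _ => //.
rewrite leeD2l//; apply: le_trans vU _.
apply: (@le_trans _ _ (\sum_(i < m) (2 * q ^+ k)%:E * vol (@eball R k r))%E).
  apply: lee_sum => i _; apply: le_trans (vol_setU_le _ _ _ _ _) _ => //.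
  rewrite mulr_natl mulr2n EFinD ge0_muleDl ?lee_fin ?exprn_ge0 ?expR_ge0//.
  apply: leeD; apply: vol_cap_le => //.
  by have := Ad i; rewrite /enorm dotpNl dotpC dotpNl opprK.
rewrite -ge0_sume_distrl; last first.
  by move=> i _; rewrite lee_fin mulr_ge0// exprn_ge0// expR_ge0.
by rewrite sumEFin sumr_const card_ord.
Qed.

End caps.

(** * Half of a small ball survives the cuts *)

Section half.
Variable R : realType.

(** Here [(d r)^-2 = 25 ln m / k], so each cap has relative volume [m^(-25/2)],
    and already [2 m * m^-3 <= 1/2]. *)
Lemma union_bound_le_half (m k : nat) (d r : R) : (2 <= m)%N -> (0 < k)%N -> 0 < d ->
  r = Num.sqrt (k%:R / ln m%:R) / (5 * d) ->
  (2 * expR (- ((d * r) ^- 2 / 2)) ^+ k) *+ m <= 2^-1.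
Proof.
move=> m2 k0 d0 rE.
have m0 : 0 < m%:R :> R by rewrite ltr0n (leq_trans _ m2).
have L0 : 0 < ln (m%:R : R) by rewrite ln_gt0// ltr1n.
have k0' : 0 < k%:R :> R by rewrite ltr0n.
have dr : (d * r) ^- 2 = 25 * ln m%:R / k%:R.
  rewrite rE (_ : d * _ = Num.sqrt (k%:R / ln m%:R) / 5); last by field; rewrite gt_eqF.
  rewrite exprMn sqr_sqrtr; last by rewrite divr_ge0// ltW.
  by field; rewrite !gt_eqF.
rewrite -expRM_natl dr.
have -> : k%:R * - (25 * ln m%:R / k%:R / 2) = - (25 / 2 * ln m%:R) :> R.
  by field; rewrite gt_eqF.
have qE : expR (- (25 / 2 * ln m%:R)) <= m%:R ^- 3 :> R.
  rewrite -[X in X ^- 3](@lnK R) ?posrE// -expRM_natl -expRN ler_expR lerN2.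
  by rewrite ler_pM2r//; lra.
rewrite -mulr_natr; apply: (@le_trans _ _ (2 * m%:R ^- 3 * m%:R)).
  by rewrite ler_pM2r// ler_pM2l.
have -> : 2 * m%:R ^- 3 * m%:R = 2 / m%:R ^+ 2 :> R by field; rewrite gt_eqF.
have m4 : 4 <= m%:R ^+ 2 :> R by rewrite -natrX ler_nat; exact: (leq_mul m2 m2).
by rewrite ler_pdivrMr ?exprn_gt0//; lra.
Qed.

Lemma vol_polytope_ball_ge_half (m k : nat) (A : 'M[R]_(m, k)) (d r : R) :
  (2 <= m)%N -> (0 < k)%N -> 0 < d -> (forall i, enorm (row i A)^T <= d) ->
  r = Num.sqrt (k%:R / ln m%:R) / (5 * d) ->
  ((2^-1)%:E * vol (@eball R k r) <= vol (linf_polytope A `&` @eball R k r))%E.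
Proof.
move=> m2 k0 d0 Ad rE.
have L0 : 0 < ln (m%:R : R) by rewrite ln_gt0// ltr1n.
have r0 : 0 < r.
  by rewrite rE divr_gt0 ?mulr_gt0// sqrtr_gt0 divr_gt0// ltr0n.
have := vol_polytope_ball_ge _ _ _ A _ _ d0 r0 Ad.
have := union_bound_le_half _ _ _ _ m2 k0 d0 rE.
set q := _ *+ m => q2.
have Bfin : vol (@eball R k r) \is a fin_num by exact: vol_eball_fin_num.
have : (vol (linf_polytope A `&` @eball R k r) <= vol (@eball R k r))%E.
  exact: vol_polytope_ball_le.
have := vol_eball_gt0 R k _ r0.
rewrite -(fineK Bfin); set V := fine _; rewrite lte_fin => V0.
have : (0 <= vol (linf_polytope A `&` @eball R k r))%E by exact: measure_ge0.
case: (vol (_ `&` _)) => [W| |]//.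
rewrite -!EFinM -EFinD !lee_fin => W0 WV VW.
have : q * V <= 2^-1 * V by rewrite ler_pM2r.
by lra.
Qed.

End half.

(** * Sections of the polytope *)

Section sections.
Variable R : realType.

(** In the coordinates of an orthonormal frame, a section of the polytope is again
    a polytope, with matrix [A *m frame H]. *)
Lemma vol_in_polytope_ball m n (A : 'M[R]_(m, n)) (H : {vspace 'cV[R]_n}) (r : R) :
  vol_in H (linf_polytope A `&` [set` H] `&` @eball R n r) =
  vol (linf_polytope (A *m frame H) `&` @eball R _ r).
Proof.
have [QQ QH] := frameP H.
have eE t : enorm (frame H *m t) = enorm t by rewrite /enorm dotp_isometry.
rewrite /vol_in; congr (vol _); apply/seteqP; split=> t.
  move=> [[At _]]; rewrite /eball/= eE => tr; split=> //.
  by rewrite /linf_polytope/= -mulmxA.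
move=> [At tr]; split; last by rewrite /eball/= eE.
by split; [move: At; rewrite /linf_polytope/= -mulmxA|exact: QH].
Qed.

Lemma vol_ratio_ge0 m n (A : 'M[R]_(m, n)) (H : {vspace 'cV[R]_n}) (r : R) :
  0 <= fine (vol_in H (linf_polytope A `&` [set` H] `&` @eball R n r)) /
    fine (vol (@eball R (\dim H) r)).
Proof. by rewrite divr_ge0// fine_ge0//; exact: measure_ge0. Qed.

(** Makes the supremum defining [vrk] an upper bound of the ratios. *)
Lemma vr_le1 m n (A : 'M[R]_(m, n)) (H : {vspace 'cV[R]_n}) (r : R) : 0 < r ->
  vr (linf_polytope A) H r <= 1.
Proof.
move=> r0; rewrite (_ : 1 = 1 `^ (\dim H)%:R^-1); last by rewrite powR1.
apply: ge0_ler_powR; rewrite ?nnegrE ?invr_ge0 ?vol_ratio_ge0//.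
rewrite ler_pdivrMr ?fine_vol_eball_gt0// mul1r vol_in_polytope_ball.
apply: fine_le; [exact: vol_polytope_ball_fin_num| |exact: vol_polytope_ball_le].
exact: vol_eball_fin_num.
Qed.

(** The ball of radius [2 c r] is small enough for half of it to lie in the section;
    this half fills at least the proportion [(2 c)^k / 2 >= c^k] of the ball of
    radius [r]. *)
Lemma vr_ge m n (A : 'M[R]_(m, n)) (H : {vspace 'cV[R]_n}) (c d r : R) :
  (2 <= m)%N -> (0 < \dim H)%N -> 0 < c -> 2 * c <= 1 -> 0 < d ->
  (forall i, enorm (row i (A *m frame H))^T <= d) ->
  r = Num.sqrt ((\dim H)%:R / ln m%:R) / (10 * c * d) ->
  c <= vr (linf_polytope A) H r.
Proof.
move=> m2; rewrite /vr vol_in_polytope_ball.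
move: (A *m frame H); move: (\dim H) => k B k0 c0 c1 d0 Bd rE.
have L0 : 0 < ln (m%:R : R) by rewrite ln_gt0// ltr1n.
have r0 : 0 < r.
  by rewrite rE divr_gt0 ?mulr_gt0// sqrtr_gt0 divr_gt0// ltr0n.
have c20 : 0 < 2 * c by rewrite mulr_gt0.
have sE : 2 * c * r = Num.sqrt (k%:R / ln m%:R) / (5 * d).
  by rewrite rE; field; rewrite !gt_eqF.
have half := vol_polytope_ball_ge_half _ _ _ B _ _ m2 k0 d0 Bd sE.
have V0 := fine_vol_eball_gt0 R k r r0.
have Vfin : vol (@eball R k r) \is a fin_num by exact: vol_eball_fin_num.
have mono : (vol (linf_polytope B `&` @eball R k (2 * c * r)) <=
    vol (linf_polytope B `&` @eball R k r))%E.
  apply: vol_le; try by apply: coord_measurable_polytope_ball; rewrite ?mulr_ge0 ?ltW.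
  move=> x [xB xr]; split=> //; apply: le_trans xr _.
  by rewrite ger_pMl.
have ratio : c ^+ k <= fine (vol (linf_polytope B `&` @eball R k r)) /
    fine (vol (@eball R k r)).
  rewrite ler_pdivlMr// -lee_fin EFinM !fineK ?vol_polytope_ball_fin_num//.
  apply: le_trans mono; apply: le_trans half.
  rewrite vol_eballM ?(ltW r0)// muleA -EFinM.
  rewrite -(fineK Vfin) -!EFinM lee_fin ler_pM2r// exprMn mulrA.
  rewrite ler_peMl ?exprn_ge0 ?(ltW c0)//.
  rewrite -(prednK k0) exprS mulrA mulVf// mul1r.
  by apply: exprn_ege1; rewrite ler1n.
have -> : c = (c ^+ k) `^ k%:R^-1.
  rewrite -powR_mulrn ?(ltW c0)// -powRrM divff ?powRr1 ?(ltW c0)//.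
  by rewrite pnatr_eq0 -lt0n.
apply: ge0_ler_powR; rewrite ?nnegrE ?invr_ge0 ?exprn_ge0 ?(ltW c0)//.
by apply: le_trans ratio; rewrite exprn_ge0// ltW.
Qed.

Lemma approx_radius_ge m n (A : 'M[R]_(m, n)) (H : {vspace 'cV[R]_n}) (c d : R) :
  (2 <= m)%N -> (0 < \dim H)%N -> 0 < c -> 2 * c <= 1 -> 0 < d ->
  (forall i, enorm (row i (A *m frame H))^T <= d) ->
  ((Num.sqrt ((\dim H)%:R / ln m%:R) / (10 * c * d))%:E <=
    approx_radius c (\dim H) (linf_polytope A))%E.
Proof.
move=> m2 k0 c0 c1 d0 Ad; apply: ereal_sup_ubound.
set r := (X in X%:E); exists r => //.
have L0 : 0 < ln (m%:R : R) by rewrite ln_gt0// ltr1n.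
have r0 : 0 < r.
  by rewrite /r divr_gt0 ?mulr_gt0// sqrtr_gt0 divr_gt0// ltr0n.
split=> //; apply: le_trans (vr_ge _ _ _ _ _ _ _ m2 k0 c0 c1 d0 Ad erefl) _.
apply: ub_le_sup; last by exists H.
by exists 1 => _ [G _ <-]; exact: vr_le1.
Qed.

End sections.

(** * Kolmogorov widths of the polar *)

Section widths.
Variable R : realType.

(** The full-rank factorisation [P = col_base P *m row_base P] identifies the image
    of [P] with that of the injective map [col_base P]. *)
Lemma dim_lker_mulmx n (P : 'M[R]_n) :
  \dim (lker (linfun (mulmx P) : 'Hom('cV[R]_n, 'cV[R]_n))) = (n - \rank P)%N.
Proof.
set f : 'Hom('cV[R]_n, 'cV[R]_n) := linfun (mulmx P).
pose g : 'Hom('cV[R]_(\rank P), 'cV[R]_n) := linfun (mulmx (col_base P)).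
have [C CE] := row_fullP (col_base_full P).
have [D DE] := row_freeP (row_base_free P).
have fg : limg f = limg g.
  apply/eqP; rewrite eqEsubv; apply/andP; split; apply/subvP => v /memv_imgP[u _ ->].
    apply/memv_imgP; exists (row_base P *m u); rewrite ?memvf//.
    by rewrite !lfunE/= mulmxA mulmx_base.
  apply/memv_imgP; exists (D *m u); rewrite ?memvf//.
  rewrite !lfunE/= -[X in X *m (D *m u)]mulmx_base -mulmxA (mulmxA (row_base P)) DE.
  by rewrite mul1mx.
have g0 : (lker g == 0)%VS.
  have CK (w : 'cV[R]_(\rank P)) : C *m (col_base P *m w) = w.
    by rewrite mulmxA CE mul1mx.
  by apply/lker0P => u v; rewrite !lfunE/= => /(congr1 (mulmx C)); rewrite !CK.
have := limg_ker_dim f fullv; have := limg_ker_dim g fullv.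
rewrite (eqP g0) capv0 capfv fg !dimvf /dim/= !muln1 dimv0 add0n => ->.
by move=> nE; rewrite -[X in (X - _)%N]nE addnK.
Qed.

Lemma lker_frame n (P : 'M[R]_n) :
  P *m frame (lker (linfun (mulmx P) : 'Hom('cV[R]_n, 'cV[R]_n))) = 0.
Proof.
set H := lker _; have [_ QH] := frameP H.
apply/matrixP => i j; rewrite [RHS]mxE.
have := QH (delta_mx j 0); rewrite memv_ker lfunE/= mulmxA -colE.
by move=> /eqP/matrixP/(_ i 0); rewrite !mxE.
Qed.

(** The transposed frame of [ker P] kills the range of [P], since [P] is symmetric,
    so it sends [a_i] and [a_i - P a_i] to the same vector; Bessel's inequality
    concludes. *)
Lemma section_row_le m n (A : 'M[R]_(m, n)) j (P : 'M[R]_n) i :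
  orth_proj j P ->
  enorm (row i (A *m frame (lker (linfun (mulmx P) : 'Hom('cV[R]_n, 'cV[R]_n)))))^T <=
  enorm ((row i A)^T - P *m (row i A)^T).
Proof.
move=> [_ PT _]; set H := lker _; have [QQ _] := frameP H.
have -> : (row i (A *m frame H))^T =
    (frame H)^T *m ((row i A)^T - P *m (row i A)^T).
  have QP : (frame H)^T *m P = 0.
    by apply: trmx_inj; rewrite trmx_mul trmxK PT lker_frame trmx0.
  by rewrite row_mul trmx_mul mulmxBr (mulmxA _ P) QP mul0mx subr0.
by rewrite /enorm ler_sqrt ?dotp_ge0// dotp_tr_isometry_le.
Qed.

Lemma enorm_proj_le n j (P : 'M[R]_n) (y : 'cV[R]_n) :
  orth_proj j P -> enorm (y - P *m y) <= enorm y.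
Proof.
move=> [PP PT _]; rewrite /enorm ler_sqrt ?dotp_ge0//.
have PyE : dotp (P *m y) (P *m y) = dotp y (P *m y).
  by rewrite dotp_mull PT mulmxA PP.
rewrite dotpBl 2!(dotpC _ _ _ (_ - _)) !dotpBl (dotpC _ _ (P *m y) y).
by have := dotp_ge0 _ _ (P *m y); rewrite PyE; lra.
Qed.

Lemma row_polar m n (A : 'M[R]_(m, n)) i : polar (linf_polytope A) (row i A)^T.
Proof.
move=> x /linf_polytopeP/(_ i); rewrite dotpC.
by apply: le_trans; exact: ler_norm.
Qed.

(** The polytope contains [w] scaled down by [`|A *m w| + 1]. *)
Lemma polar_linf_polytope_le m n (A : 'M[R]_(m, n)) (y w : 'cV[R]_n) :
  polar (linf_polytope A) y -> dotp w y <= `|A *m w| + 1.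
Proof.
set s := _ + 1 => /(_ (s^-1 *: w)).
have s0 : 0 < s by rewrite /s addrC ltr_pwDl.
rewrite dotpZl ler_pdivrMl// mulr1; apply.
rewrite /linf_polytope/= -scalemxAr normrZ ger0_norm ?invr_ge0 ?(ltW s0)//.
by rewrite ler_pdivrMl// mulr1 /s lerDl.
Qed.

(** Guarantees that the suprema defining [kolmogorov_width] are upper bounds. *)
Lemma polar_linf_polytope_bounded m n (A : 'M[R]_(m, n)) :
  exists M, forall y, polar (linf_polytope A) y -> enorm y <= M.
Proof.
pose C (j : 'I_n) := `|A *m (delta_mx j 0 : 'cV[R]_n)| + 1.
exists (Num.sqrt (\sum_(j < n) C j ^+ 2)) => y Ay.
rewrite /enorm ler_sqrt; last by apply: sumr_ge0 => j _; exact: sqr_ge0.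
apply: ler_sum => j _; rewrite -expr2 -real_normK ?num_real//.
rewrite ler_pXn2r ?nnegrE ?addr_ge0//.
have dE : dotp (delta_mx j 0) y = y j 0.
  rewrite /dotp (bigD1 j)//= big1 => [|i ij]; rewrite !mxE ?eqxx ?mul1r ?addr0//.
  by rewrite (negPf ij) mul0r.
rewrite ler_norml -dE lerNl -dotpNl polar_linf_polytope_le// andbT.
by rewrite /C -[`|_|]normrN -mulmxN polar_linf_polytope_le.
Qed.

(** A nonzero infimum comes from a nonempty set bounded below, so it is
    approached within any [d - kolmogorov_width j K > 0]. *)
Lemma kolmogorov_width_proj m n (A : 'M[R]_(m, n)) j (d : R) :
  let K := polar (linf_polytope A) in
  0 < kolmogorov_width j K -> kolmogorov_width j K < d ->
  exists2 P, orth_proj j P & forall y, K y -> enorm (y - P *m y) <= d.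
Proof.
move=> K w0 wd.
have hinf : has_inf [set sup [set enorm (x - P *m x) | x in K] | P in @orth_proj R n j].
  by apply: contrapT => /inf_out w; move: w0; rewrite /kolmogorov_width w ltxx.
have wd' : 0 < d - kolmogorov_width j K by rewrite subr_gt0.
have [_ [P jP <-]] := inf_adherent wd' hinf.
rewrite -/(kolmogorov_width j K) addrC subrK => Pd.
exists P => // y Ky; apply: le_trans (ltW Pd); apply: ub_le_sup; last by exists y.
have [M KM] := polar_linf_polytope_bounded _ _ A.
by exists M => _ [x Kx <-]; apply: le_trans (KM x Kx); exact: enorm_proj_le jP.
Qed.

Lemma approx_radius_ge_proj m n k (A : 'M[R]_(m, n)) (P : 'M[R]_n) (c d : R) :
  (2 <= m)%N -> (0 < k)%N -> (k <= n)%N -> 0 < c -> 2 * c <= 1 -> 0 < d ->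
  orth_proj (n - k) P ->
  (forall i, enorm ((row i A)^T - P *m (row i A)^T) <= d) ->
  ((Num.sqrt (k%:R / ln m%:R) / (10 * c * d))%:E <=
    approx_radius c k (linf_polytope A))%E.
Proof.
move=> m2 k0 kn c0 c1 d0 jP Pd.
have := dim_lker_mulmx _ P; case: (jP) => _ _ ->; rewrite subKn//.
set H := lker _ => Hk; rewrite -Hk.
apply: approx_radius_ge; rewrite ?Hk// => i.
exact: le_trans (section_row_le _ _ A _ _ i jP) (Pd i).
Qed.

Lemma orth_proj_exists n j : (j <= n)%N -> exists P : 'M[R]_n, orth_proj j P.
Proof.
move=> jn; exists (pid_mx j); split; last exact: rank_pid_mx.
  exact: pid_mx_id.
exact: tr_pid_mx.
Qed.

(** [ln u <= u - 1 <= u^2 / 4], the last step being [(u / 2 - 1)^2 >= 0]. *)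
Lemma sqrt_ln_le (u : R) : 0 < u -> Num.sqrt (ln u) <= u / 2.
Proof.
move=> u0; rewrite -[leRHS]ger0_norm ?divr_ge0 ?(ltW u0)// -sqrtr_sqr.
rewrite ler_sqrt ?sqr_ge0//; have u1 : -1 < u - 1 by rewrite ltrBrDr addNr.
have := le_ln1Dx u1; rewrite addrC subrK => /le_trans; apply.
by have := sqr_ge0 (u / 2 - 1); lra.
Qed.

End widths.

(** * The lower bound on the approximation radius *)

Theorem theorem3p4 (R : realType) (m n : nat) (A : 'M[R]_(m, n)) (c : R)
    (k : nat) (m_ge2 : (2 <= m)%N) (n_ge1 : (1 <= n)%N)
    (X_bounded : bounded_set (linf_polytope A))
    (c_gt0 : 0 < c) (c_le : c <= 2 / 10)
    (k_gt0 : (0 < k)%N) (k_le : (k <= n)%N) :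
  let X := linf_polytope A in
  let c2 : R := 4 / 10 * Num.sqrt (ln (1 / (2 * c))) in
  ((c2 * Num.sqrt (k%:R / ln m%:R) *
    (1 / kolmogorov_width (n - k) (polar X)))%:E <= approx_radius c k X)%E.
Proof.
cbv zeta; set c2 := 4 / 10 * _.
set S := Num.sqrt (k%:R / _); set w := kolmogorov_width _ _.
have S0 : 0 <= S by exact: sqrtr_ge0.
have c1 : 2 * c <= 1 by lra.
have c20 : 0 <= c2 by rewrite mulr_ge0// sqrtr_ge0.
have c2_le : c2 <= (10 * c)^-1.
  have u0 : 0 < 1 / (2 * c) by rewrite divr_gt0// mulr_gt0.
  have := sqrt_ln_le _ _ u0; rewrite /c2.
  have -> : (10 * c)^-1 = 2 / 10 * (1 / (2 * c)) by field; rewrite gt_eqF.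
  by lra.
have [w0|w0] := leP w 0.
  (* The left-hand side is then nonpositive, but the supremum on the right is -oo
     unless some radius is admissible: any projection provides one. *)
  have [P jP] := orth_proj_exists R n (n - k) (leq_subr _ _).
  pose d := 1 + \sum_(i < m) enorm ((row i A)^T - P *m (row i A)^T).
  have s0 (J : pred 'I_m) :
      0 <= \sum_(i < m | J i) enorm ((row i A)^T - P *m (row i A)^T).
    by apply: sumr_ge0 => i _; exact: enorm_ge0.
  have d0 : 0 < d by rewrite ltr_pwDl.
  apply: (@le_trans _ _ 0%E).
    by rewrite lee_fin mulr_ge0_le0 ?mulr_ge0// mul1r invr_le0.
  apply: le_trans
    (approx_radius_ge_proj _ _ _ _ A P _ d m_ge2 k_gt0 k_le c_gt0 c1 d0 jP _).
    by rewrite lee_fin divr_ge0// !mulr_ge0// ltW.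
  by move=> i; rewrite /d (bigD1 i)//= addrCA lerDl addr_ge0.
(* Shrinking the left-hand side by r in (0, 1) allows width w / r > w. *)
apply/lee_mul01Pr; first by rewrite lee_fin !mulr_ge0// invr_ge0 ltW.
move=> r /andP[r0 r1].
have d0 : 0 < w / r by rewrite divr_gt0.
have wd : w < w / r by rewrite ltr_pdivlMr// gtr_pMr.
have [P jP Pd] := kolmogorov_width_proj _ _ _ A _ _ w0 wd.
apply: le_trans
  (approx_radius_ge_proj _ _ _ _ A P _ _ m_ge2 k_gt0 k_le c_gt0 c1 d0 jP _).
  rewrite -EFinM lee_fin.
  have -> : S / (10 * c * (w / r)) = (10 * c)^-1 * (r * (S * w^-1)).
    by field; rewrite !gt_eqF.
  have -> : r * (c2 * S * (1 / w)) = c2 * (r * (S * w^-1)) by rewrite mul1r; ring.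
  by rewrite ler_wpM2r// !mulr_ge0// ?invr_ge0 ltW.
by move=> i; apply: Pd; exact: row_polar.
Qed.
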